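(* Let $a,b,c,d,R,S$ be real numbers with $a,b,c,d,R,S>0$. Then $$R\,\sin^{-1}\left\{\sqrt{\frac{ab}{(R+a)(R+b)}}\right\}+S\,\sin^{-1}\left\{\sqrt{\frac{cd}{(S+c)(S+d)}}\right\}\le (R+S)\,\sin^{-1}\left\{\sqrt{\frac{(a+c)(b+d)}{(R+S+a+c)(R+S+b+d)}}\right\}.$$
   Context: Here $\sin^{-1}:[0,1]\to[0,\pi/2]$ denotes the principal inverse sine (arcsine), and square roots are nonnegative. *)

(* Defs.v *)
(* [asin] below is the principal inverse sine; on [0, 1] its values lie in
   [0, PI/2]. *)
From Stdlib Require Export Reals.

(* Main.v *)
(* With [x = sqrt (a b / ((r+a)(r+b)))] one has [asin x = atan (N a b r / r)],
   where [N a b r = sqrt (a b r / (a+b+r))] is the inradius of the triangle with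
   tangent lengths [a], [b], [r]. [N] is concave and homogeneous of degree 1,
   hence superadditive, and [atan] is concave and increasing on [0, +oo). *)
Require Import Defs.
From Stdlib Require Import Reals Lra Psatz.
Open Scope R_scope.

(** By the mean value theorem the chord slope is [/ (1 + z ^ 2)] for some [z] between [t] and [u],
    and this derivative decreases on [0, +oo). *)
Lemma atan_le_tangent (t u : R) : 0 <= t -> 0 <= u ->
  atan t <= atan u + (t - u) / (1 + u ^ 2).
Proof.
intros ht hu.
assert (inv_le : forall x y, 0 <= x <= y -> / (1 + y ^ 2) <= / (1 + x ^ 2)).
{ intros x y hxy. apply Rinv_le_contravar; nra. }
unfold Rdiv.
destruct (Rtotal_order t u) as [lt | [-> | gt]].
- destruct (MVT_cor2 atan _ t u lt (fun x _ => derivable_pt_lim_atan x)) as [z [eq hz]].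
  assert (h := inv_le z u ltac:(lra)). nra.
- lra.
- destruct (MVT_cor2 atan _ u t gt (fun x _ => derivable_pt_lim_atan x)) as [z [eq hz]].
  assert (h := inv_le u z ltac:(lra)). nra.
Qed.

(** Both values lie below the tangent at the weighted mean [m]; in the weighted sum the first-order
    terms cancel. *)
Lemma atan_concave (r s t u : R) : 0 < r -> 0 < s -> 0 <= t -> 0 <= u ->
  r * atan t + s * atan u <= (r + s) * atan ((r * t + s * u) / (r + s)).
Proof.
intros hr hs ht hu.
set (m := (r * t + s * u) / (r + s)).
assert (hm : (r + s) * m = r * t + s * u) by (unfold m; field; lra).
assert (m_ge0 : 0 <= m) by nra.
assert (ht' := atan_le_tangent t m ht m_ge0).
assert (hu' := atan_le_tangent u m hu m_ge0).
unfold Rdiv in *.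
set (k := / (1 + m ^ 2)) in *.
apply Rle_trans with
  (r * (atan m + (t - m) * k) + s * (atan m + (u - m) * k)).
- apply Rplus_le_compat; apply Rmult_le_compat_l; lra.
- apply Req_le.
  replace (r * (atan m + (t - m) * k) + s * (atan m + (u - m) * k))
    with ((r + s) * atan m + (r * t + s * u - (r + s) * m) * k) by ring.
  rewrite hm. ring.
Qed.

(* With [q = x + z - A] the hypothesis gives [A q >= x z], and then
   [A (y + q)^2 >= 4 A y q >= 4 x y z]. *)
Lemma four_prod_le_between (x y z A : R) : 0 < y -> 0 < A ->
  (A - x) * (A - z) <= 0 ->
  4 * (x * y * z) <= (x + y + z - A) ^ 2 * A.
Proof.
intros hy hA hxz.
replace (x + y + z - A) with (y + (x + z - A)) by ring.
assert (hq : x * z <= A * (x + z - A)) by lra.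
set (q := x + z - A) in *.
assert (y * (x * z) <= y * (A * q)) by (apply Rmult_le_compat_l; lra).
assert (0 <= A * (y - q) ^ 2) by (apply Rmult_le_pos; [lra | apply pow2_ge_0]).
lra.
Qed.

(** Otherwise [A - x], [A - y], [A - z] would share a strict sign, although their sum with positive
    weights is 0. *)
Lemma weighted_mean_between (p q s x y z A : R) : 0 < p -> 0 < q -> 0 < s ->
  p * x + q * y + s * z = A * (p + q + s) ->
  (A - x) * (A - y) <= 0 \/ (A - y) * (A - z) <= 0 \/ (A - x) * (A - z) <= 0.
Proof.
intros hp hq hs hA.
assert (sum0 : p * (A - x) + q * (A - y) + s * (A - z) = 0) by lra.
destruct (Rle_or_lt ((A - x) * (A - y)) 0) as [h | h1]; [now left |].
destruct (Rle_or_lt ((A - y) * (A - z)) 0) as [h | h2]; [now right; left |].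
destruct (Rle_or_lt ((A - x) * (A - z)) 0) as [h | h3]; [now right; right |].
exfalso.
destruct (Rtotal_order (A - x) 0) as [hx | [hx | hx]].
- assert (A - y < 0) by nra. assert (A - z < 0) by nra. nra.
- rewrite hx in h1. lra.
- assert (0 < A - y) by nra. assert (0 < A - z) by nra. nra.
Qed.

(** The claim is symmetric in [x], [y], [z], so whichever pair [A] separates can play the outer
    roles in [four_prod_le_between]. *)
Lemma four_prod_le_weighted_mean (p q s x y z A : R) :
  0 < p -> 0 < q -> 0 < s -> 0 < x -> 0 < y -> 0 < z ->
  p * x + q * y + s * z = A * (p + q + s) ->
  4 * (x * y * z) <= (x + y + z - A) ^ 2 * A.
Proof.
intros hp hq hs hx hy hz hA.
assert (px := Rmult_lt_0_compat p x hp hx).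
assert (qy := Rmult_lt_0_compat q y hq hy).
assert (sz := Rmult_lt_0_compat s z hs hz).
assert (A_gt0 : 0 < A) by nra.
destruct (weighted_mean_between p q s x y z A hp hq hs hA) as [h | [h | h]].
- generalize (four_prod_le_between x z y A hz A_gt0 h).
  replace (x + z + y) with (x + y + z) by ring. lra.
- generalize (four_prod_le_between y x z A hx A_gt0 h).
  replace (y + x + z) with (x + y + z) by ring. lra.
- exact (four_prod_le_between x y z A hy A_gt0 h).
Qed.

Definition inradius (a b c : R) : R := sqrt (a * b * c / (a + b + c)).

Lemma inradius_gt0 (a b c : R) : 0 < a -> 0 < b -> 0 < c -> 0 < inradius a b c.
Proof.
intros ha hb hc. apply sqrt_lt_R0. apply Rdiv_lt_0_compat; [| lra].
repeat apply Rmult_lt_0_compat; assumption.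
Qed.

Lemma inradius_sqr (a b c : R) : 0 < a -> 0 < b -> 0 < c ->
  inradius a b c ^ 2 = a * b * c / (a + b + c).
Proof.
intros ha hb hc. unfold inradius. apply pow2_sqrt.
apply Rlt_le, Rdiv_lt_0_compat; [| lra].
repeat apply Rmult_lt_0_compat; assumption.
Qed.

(* The tangent plane inequality for [inradius] at [(p, q, s)], evaluated at the
   point [(p x, q y, s z)]. *)
Lemma inradius_le_tangent (p q s x y z : R) :
  0 < p -> 0 < q -> 0 < s -> 0 < x -> 0 < y -> 0 < z ->
  2 * inradius (p * x) (q * y) (s * z) <=
  inradius p q s * (x + y + z - (p * x + q * y + s * z) / (p + q + s)).
Proof.
intros hp hq hs hx hy hz.
assert (px := Rmult_lt_0_compat p x hp hx).
assert (qy := Rmult_lt_0_compat q y hq hy).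
assert (sz := Rmult_lt_0_compat s z hs hz).
set (A := (p * x + q * y + s * z) / (p + q + s)).
assert (hA : p * x + q * y + s * z = A * (p + q + s)) by (unfold A; field; lra).
assert (A_gt0 : 0 < A) by (apply Rdiv_lt_0_compat; lra).
assert (A_le : A <= x + y + z).
{ apply Rmult_le_reg_r with (p + q + s); [lra |]. rewrite <- hA. nra. }
assert (key := four_prod_le_weighted_mean p q s x y z A hp hq hs hx hy hz hA).
assert (m_gt0 := inradius_gt0 _ _ _ px qy sz).
assert (n_gt0 := inradius_gt0 _ _ _ hp hq hs).
assert (sqr : inradius (p * x) (q * y) (s * z) ^ 2 * A
              = inradius p q s ^ 2 * (x * y * z)).
{ rewrite !inradius_sqr by assumption. rewrite hA. field. lra. }
set (m := inradius (p * x) _ _) in *. set (n := inradius p q s) in *.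
(* Squares suffice, since [A_le] makes the right side nonnegative. After multiplication by [A],
   [sqr] turns the left side into [n ^ 2 * (4 * (x * y * z))], which [key] bounds. *)
apply Rsqr_incr_0_var; [| apply Rmult_le_pos; lra].
unfold Rsqr.
apply Rmult_le_reg_r with A; [exact A_gt0 |].
apply Rle_trans with (n ^ 2 * (4 * (x * y * z))); [lra |].
apply Rle_trans with (n ^ 2 * ((x + y + z - A) ^ 2 * A)); [| lra].
apply Rmult_le_compat_l; [nra | exact key].
Qed.

(** The tangent plane at the sum of the two points bounds both terms; by homogeneity the two bounds
    add up to the value at the sum. *)
Lemma inradius_superadditive (a b c a' b' c' : R) :
  0 < a -> 0 < b -> 0 < c -> 0 < a' -> 0 < b' -> 0 < c' ->
  inradius a b c + inradius a' b' c' <= inradius (a + a') (b + b') (c + c').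
Proof.
intros ha hb hc ha' hb' hc'.
set (p := a + a'). set (q := b + b'). set (s := c + c').
assert (hp : 0 < p) by (unfold p; lra).
assert (hq : 0 < q) by (unfold q; lra).
assert (hs : 0 < s) by (unfold s; lra).
assert (h := inradius_le_tangent p q s (a / p) (b / q) (c / s) hp hq hs
  ltac:(apply Rdiv_lt_0_compat; lra) ltac:(apply Rdiv_lt_0_compat; lra)
  ltac:(apply Rdiv_lt_0_compat; lra)).
assert (h' := inradius_le_tangent p q s (a' / p) (b' / q) (c' / s) hp hq hs
  ltac:(apply Rdiv_lt_0_compat; lra) ltac:(apply Rdiv_lt_0_compat; lra)
  ltac:(apply Rdiv_lt_0_compat; lra)).
assert (mul_div : forall u v, 0 < u -> u * (v / u) = v)
  by (intros u v hu; field; lra).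
rewrite !mul_div in h, h' by assumption.
set (n := inradius p q s) in *.
(* The ratios sum to 1 in each of the three coordinates, and the subtracted quotients sum to 1: 3 -
   1 = 2. *)
assert (sum : n * (a / p + b / q + c / s - (a + b + c) / (p + q + s))
  + n * (a' / p + b' / q + c' / s - (a' + b' + c') / (p + q + s)) = 2 * n).
{ unfold p, q, s. field. lra. }
lra.
Qed.

(** If [v] is the squared sine, the squared tangent is [v / (1 - v)], that is
    [a * b / (r * (a + b + r))]. *)
Lemma asin_eq_atan_inradius (a b r : R) : 0 < a -> 0 < b -> 0 < r ->
  asin (sqrt (a * b / ((r + a) * (r + b)))) = atan (inradius a b r / r).
Proof.
intros ha hb hr.
assert (ab := Rmult_lt_0_compat a b ha hb).
assert (den : 0 < (r + a) * (r + b)) by (apply Rmult_lt_0_compat; lra).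
set (v := a * b / ((r + a) * (r + b))).
assert (v_gt0 : 0 < v) by (apply Rdiv_lt_0_compat; lra).
assert (v_compl : 1 - v = r * (a + b + r) / ((r + a) * (r + b)))
  by (unfold v; field; lra).
assert (compl_gt0 : 0 < 1 - v).
{ rewrite v_compl. apply Rdiv_lt_0_compat; [nra | exact den]. }
assert (0 < sqrt v) by (apply sqrt_lt_R0; exact v_gt0).
assert (sqrt v < 1) by (rewrite <- sqrt_1; apply sqrt_lt_1; lra).
rewrite asin_atan by lra. f_equal.
rewrite Rsqr_sqrt, <- sqrt_div_alt by lra.
unfold inradius.
(* The third [r] is the outer denominator; as a root it merges with the numerator. *)
rewrite <- (sqrt_pow2 r) at 3 by lra.
rewrite <- sqrt_div_alt by nra.
f_equal. rewrite v_compl. unfold v. field. lra.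
Qed.

Theorem theorem1 (a b c d r s : R)
  (ha : 0 < a) (hb : 0 < b) (hc : 0 < c) (hd : 0 < d) (hr : 0 < r) (hs : 0 < s) :
  r * asin (sqrt (a * b / ((r + a) * (r + b))))
  + s * asin (sqrt (c * d / ((s + c) * (s + d))))
  <= (r + s) *
     asin (sqrt ((a + c) * (b + d) / ((r + s + a + c) * (r + s + b + d)))).
Proof.
replace (r + s + a + c) with (r + s + (a + c)) by ring.
replace (r + s + b + d) with (r + s + (b + d)) by ring.
rewrite !asin_eq_atan_inradius by lra.
assert (m_gt0 := inradius_gt0 a b r ha hb hr).
assert (n_gt0 := inradius_gt0 c d s hc hd hs).
(* The weights [r] and [s] cancel the denominators inside [atan], leaving a plain sum of inradii. *)
eapply Rle_trans; [apply atan_concave; try assumption; apply Rlt_le |].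
1, 2: apply Rdiv_lt_0_compat; assumption.
apply Rmult_le_compat_l; [lra |].
assert (le : (r * (inradius a b r / r) + s * (inradius c d s / s)) / (r + s)
             <= inradius (a + c) (b + d) (r + s) / (r + s)).
{ apply Rmult_le_compat_r; [apply Rlt_le, Rinv_0_lt_compat; lra |].
  replace (r * (inradius a b r / r) + s * (inradius c d s / s))
    with (inradius a b r + inradius c d s) by (field; lra).
  now apply inradius_superadditive. }
(* [atan_increasing] is strict, so equality is treated apart. *)
destruct le as [lt | eq].
- now apply Rlt_le, atan_increasing.
- rewrite eq. lra.
Qed.
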